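(* For $n\ge1$ define $L_n(x,y)=\sum_{k=0}^{\lfloor n/2\rfloor}L(n,k)\,x^{2k+1}y^{n-2k}$ and $W_n(x,y)=\sum_{k=1}^{\lfloor (n+1)/2\rfloor}W(n,k)\,x^{2k}y^{n-2k+1}$, and set $L_0(x,y)=x$, $W_0(x,y)=y$. Let $L(t)=L(x,y,t)=\sum_{n\ge0}L_n(x,y)\frac{t^n}{n!}$ and $W(t)=W(x,y,t)=\sum_{n\ge0}W_n(x,y)\frac{t^n}{n!}$. Then, with $'$ denoting the derivative with respect to $t$, these series satisfy the ordinary differential equations $$L'(t)=L(t)\sqrt{L^2(t)-x^2+y^2},\qquad W'(t)=W^2(t)+x^2-y^2,$$ with boundary conditions $L(x,y,0)=x$ and $W(x,y,0)=y$.
   Context: For a permutation $\sigma=\sigma_1\cdots\sigma_n$ of $[n]=\{1,\dots,n\}$: a left peak is an index $i$ with $1\le i\le n-1$ and $\sigma_{i-1}<\sigma_i>\sigma_{i+1}$, with the convention $\sigma_0=0$; an exterior peak is an index $i$ with $1\le i\le n$ and $\sigma_{i-1}<\sigma_i>\sigma_{i+1}$, with the convention $\sigma_0=\sigma_{n+1}=0$. $L(n,k)$ (resp. $W(n,k)$) is the number of permutations of $[n]$ with exactly $k$ left peaks (resp. exterior peaks). The square root is the formal power series square root in $t$ whose constant term is $y$. *)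

(* Defs.v *)
From mathcomp Require Import all_boot all_order all_algebra all_fingroup.
From mathcomp Require Import mpoly.

Set Implicit Arguments.
Unset Strict Implicit.
Unset Printing Implicit Defensive.

Import GRing.Theory.

Local Open Scope ring_scope.

(* [sigma_at s i] is the letter sigma_i, 1 <= i <= n, of the word
   sigma_1 ... sigma_n on {1, ..., n} given by s (a permutation of
   {0, ..., n-1}, hence the successor); the leading letter and the default
   value of [nth] are the conventions sigma_0 = 0 and sigma_(n+1) = 0. *)
Definition sigma_at (n : nat) (s : 'S_n) (i : nat) : nat :=
  nth 0%N (0%N :: [seq (nat_of_ord (s j)).+1 | j <- enum 'I_n]) i.

Definition is_peak (n : nat) (s : 'S_n) (i : nat) : bool :=
  (sigma_at s i.-1 < sigma_at s i)%N && (sigma_at s i.+1 < sigma_at s i)%N.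

Definition left_peaks (n : nat) (s : 'S_n) : nat :=
  count (is_peak s) (index_iota 1 n).

Definition exterior_peaks (n : nat) (s : 'S_n) : nat :=
  count (is_peak s) (index_iota 1 n.+1).

Definition Lnum (n k : nat) : nat := #|[set s : 'S_n | left_peaks s == k]|.

Definition Wnum (n k : nat) : nat := #|[set s : 'S_n | exterior_peaks s == k]|.

Notation Qxy := {mpoly rat[2]}.

Definition varx : Qxy := 'X_(ord0 : 'I_2).
Definition vary : Qxy := 'X_(ord_max : 'I_2).

Definition Lpoly (n : nat) : Qxy :=
  if n is 0 then varx else
  \sum_(0 <= k < (n./2).+1)
     (Lnum n k)%:R * varx ^+ (2 * k + 1) * vary ^+ (n - 2 * k).

(* The exponent is written n.+1 - 2 * k because n - 2 * k would be truncated
   when n = 2 * k - 1. *)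
Definition Wpoly (n : nat) : Qxy :=
  if n is 0 then vary else
  \sum_(1 <= k < (n.+1./2).+1)
     (Wnum n k)%:R * varx ^+ (2 * k) * vary ^+ (n.+1 - 2 * k).

(* A formal power series in t over A is its sequence of coefficients. *)
Definition fps (A : Type) : Type := nat -> A.

Declare Scope fps_scope.
Delimit Scope fps_scope with fps.

Section FormalPowerSeries.
Variable A : comNzRingType.
Implicit Types F G : fps A.

Definition fps_const (a : A) : fps A := fun n => if n is 0 then a else 0.
Definition fps_add F G : fps A := fun n => F n + G n.
Definition fps_sub F G : fps A := fun n => F n - G n.
Definition fps_mul F G : fps A := fun n => \sum_(i < n.+1) F i * G (n - i)%N.
Definition fps_deriv F : fps A := fun n => F n.+1 *+ n.+1.

Definition is_fps_sqrt F (c : A) (S : fps A) : Prop :=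
  fps_mul S S = F /\ S 0%N = c.

End FormalPowerSeries.

Notation "a %:S" := (fps_const a) (at level 1, format "a %:S") : fps_scope.
Notation "F + G" := (fps_add F G) : fps_scope.
Notation "F - G" := (fps_sub F G) : fps_scope.
Notation "F * G" := (fps_mul F G) : fps_scope.
Notation "F ^`()" := (fps_deriv F) : fps_scope.

Definition Lseries : fps Qxy := fun n => (n`!%:R : rat)^-1 *: Lpoly n.
Definition Wseries : fps Qxy := fun n => (n`!%:R : rat)^-1 *: Wpoly n.

(* Main.v *)
(* Write D for the derivation of Q[x, y] with D x = x y and D y = x^2.  Inserting
   the letter n+1 in all n+1 places of a permutation of [n] with k left (resp.
   exterior) peaks leaves their number unchanged in 2k+1 (resp. 2k) places and
   raises it by one in the others, which says that L_(n+1) = D L_n and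
   W_(n+1) = D W_n; hence L_n = D^n x and W_n = D^n y.  The map sending p to
   sum_n D^n(p) t^n/n! is a ring morphism that turns D into d/dt, so L' = L W
   and W' = L^2.  As D kills x^2 - y^2, also L^2 - W^2 = x^2 - y^2: the square
   root in the theorem is W itself. *)
Require Import Defs.
From mathcomp Require Import all_boot all_order all_algebra all_fingroup.
From mathcomp Require Import mpoly.
From mathcomp Require Import zify ring.
From Stdlib Require Import FunctionalExtensionality.

Set Implicit Arguments.
Unset Strict Implicit.
Unset Printing Implicit Defensive.

Import GRing.Theory Num.Theory.

Local Open Scope ring_scope.

(** * Formal power series: product rule and uniqueness of square roots *)

Lemma fps_deriv_mul (A : comNzRingType) (F G : fps A) n :
  ((F * G)^`())%fps n = (F^`() * G + F * G^`())%fps n.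
Proof.
rewrite /fps_deriv /fps_add /fps_mul -sumrMnl.
(* The factor [n.+1] is split as [i + (n.+1 - i)]: each summand differentiates one of the two
   series. *)
transitivity (\sum_(i < n.+2) (F i * G (n.+1 - i)%N *+ i
                               + F i * G (n.+1 - i)%N *+ (n.+1 - i))).
  by apply: eq_bigr => i _; rewrite -mulrnDr subnKC // -ltnS.
rewrite big_split /= big_ord_recl mulr0n add0r; congr (_ + _).
  by apply: eq_bigr => i _; rewrite mulrnAl.
rewrite big_ord_recr /= subnn mulr0n addr0.
apply: eq_bigr => i _; rewrite mulrnAr -subSn //.
by rewrite -ltnS.
Qed.

(** Since [(S - S') * (S + S') = 0], the first coefficient where [S] and [S'] differ would be killed
    by [2 * c], which is nonzero in a domain. *)
Lemma fps_sqrt_unique (A : idomainType) (F : fps A) c S S' :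
  2%:R != 0 :> A -> c != 0 ->
  is_fps_sqrt F c S -> is_fps_sqrt F c S' -> S = S'.
Proof.
move=> nz2 nzc [SF S0] [SF' S0']; apply: functional_extensionality.
elim/ltn_ind=> n IHn; apply/eqP; rewrite -subr_eq0.
have: \sum_(i < n.+1) (S i - S' i) * (S (n - i)%N + S' (n - i)%N) = 0.
  have -> : \sum_(i < n.+1) (S i - S' i) * (S (n - i)%N + S' (n - i)%N) =
      fps_mul S S n - fps_mul S' S' n + (fps_mul S S' n - fps_mul S' S n).
    rewrite /fps_mul -!sumrB -big_split; apply: eq_bigr => i _ /=; by ring.
  rewrite SF SF' subrr add0r; apply/eqP; rewrite subr_eq0; apply/eqP.
  rewrite /fps_mul (reindex_inj rev_ord_inj) /=; apply: eq_bigr => i _.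
  by rewrite mulrC subSS subKn // -ltnS.
rewrite big_ord_recr /= big1 => [|i _]; last by rewrite IHn // subrr mul0r.
rewrite add0r => /eqP.
rewrite mulf_eq0 subnn S0 S0' -mulr2n -mulr_natl mulf_eq0.
by rewrite (negPf nz2) (negPf nzc) !orbF.
Qed.

(** * The exponential series of a derivation *)

Section DerivationSeries.
Variables (A : comAlgType rat) (D : A -> A).
Hypothesis DD : {morph D : p q / p + q}.
Hypothesis DM : forall p q, D (p * q) = D p * q + p * D q.

Definition exp_deriv (p : A) : fps A := fun n => (n`!%:R : rat)^-1 *: iter n D p.

Lemma exp_derivS p n : exp_deriv p n.+1 *+ n.+1 = exp_deriv (D p) n.
Proof.
rewrite /exp_deriv -iterSr -scaler_nat scalerA; congr (_ *: _).
rewrite factS natrM invfM mulrA divff ?mul1r // pnatr_eq0 //.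
Qed.

Lemma deriv_exp_deriv p : (exp_deriv p)^`()%fps = exp_deriv (D p).
Proof. by apply: functional_extensionality => n; exact: exp_derivS. Qed.

Lemma exp_derivD p q : exp_deriv (p + q) = (exp_deriv p + exp_deriv q)%fps.
Proof.
apply: functional_extensionality => n; rewrite /exp_deriv /fps_add -scalerDr.
by congr (_ *: _); elim: n => //= n ->.
Qed.

(** Both sides obey the product rule under d/dt and share their constant term. The induction keeps
    [p] and [q] general because [D (p * q)] produces the products [D p * q] and [p * D q]; dividing
    by [n.+1] uses the rational scalars. *)
Lemma exp_derivM p q : exp_deriv (p * q) = (exp_deriv p * exp_deriv q)%fps.
Proof.
apply: functional_extensionality => n; elim: n p q => [|n IHn] p q.
  by rewrite /fps_mul big_ord1 /exp_deriv fact0 invr1 !scale1r.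
have natS_inj (u v : A) : u *+ n.+1 = v *+ n.+1 -> u = v.
  move=> /(congr1 ( *:%R (n.+1%:R : rat)^-1)).
  by rewrite -!scaler_nat !scalerA mulVf ?pnatr_eq0 // !scale1r.
apply: natS_inj; rewrite exp_derivS DM exp_derivD /fps_add !IHn.
by rewrite -!deriv_exp_deriv -[RHS]/((_^`())%fps n) fps_deriv_mul.
Qed.

Lemma exp_deriv_const p : D p = 0 -> exp_deriv p = (p%:S)%fps.
Proof.
move=> Dp0; apply: functional_extensionality => -[|n].
  by rewrite /exp_deriv fact0 invr1 scale1r.
have D0 : D 0 = 0 by apply: (addrI (D 0)); rewrite -DD !addr0.
rewrite /exp_deriv iterSr Dp0.
by rewrite [iter n D 0](_ : _ = 0) ?scaler0 //; elim: n => //= n ->.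
Qed.

End DerivationSeries.

(** * The derivation with x -> xy and y -> x^2 *)

Definition peak_deriv (p : Qxy) : Qxy :=
  varx * vary * mderiv ord0 p + varx ^+ 2 * mderiv ord_max p.

Lemma peak_derivD : {morph peak_deriv : p q / p + q}.
Proof. by move=> p q; rewrite /peak_deriv !mderivD; ring. Qed.

Lemma peak_derivM p q :
  peak_deriv (p * q) = peak_deriv p * q + p * peak_deriv q.
Proof. by rewrite /peak_deriv !mderivM; ring. Qed.

Lemma mderiv_var n (R : nzRingType) (i j : 'I_n) :
  mderiv i ('X_j : {mpoly R[n]}) = (i == j)%:R.
Proof.
rewrite mderivX mnm1E eq_sym; case: eqP => [->|_]; last by rewrite scale0r.
by rewrite -{1}[U_(j)%MM]addm0 addmC addmK mpolyX0 scale1r.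
Qed.

Lemma peak_deriv_x : peak_deriv varx = varx * vary.
Proof. by rewrite /peak_deriv !mderiv_var /= mulr1 mulr0 addr0. Qed.

Lemma peak_deriv_y : peak_deriv vary = varx ^+ 2.
Proof. by rewrite /peak_deriv !mderiv_var /= mulr1 mulr0 add0r. Qed.

Lemma derivation_exp (A : comNzRingType) (D : A -> A) p n :
  (forall p q, D (p * q) = D p * q + p * D q) ->
  D (p ^+ n) = p ^+ n.-1 * D p *+ n.
Proof.
move=> DM; elim: n => [|n IHn].
  rewrite expr0 mulr0n; apply: (addrI (D 1)).
  by rewrite -{3}[1]mulr1 DM mulr1 mul1r addr0.
rewrite exprS DM IHn /= mulrS; case: n {IHn} => [|n] /=.
  by rewrite !mulr0n; ring.
by rewrite mulrnAr exprS; ring.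
Qed.

(** The multiplicities [a] and [b] will be the numbers of insertion places that keep, respectively
    raise, the number of peaks. The truncated [b.-1] is harmless, as its term has multiplicity
    [b]. *)
Lemma peak_deriv_monomial a b :
  peak_deriv (varx ^+ a * vary ^+ b) =
    varx ^+ a * vary ^+ b.+1 *+ a + varx ^+ a.+2 * vary ^+ b.-1 *+ b.
Proof.
rewrite peak_derivM !(derivation_exp _ _ peak_derivM).
rewrite peak_deriv_x peak_deriv_y; congr (_ + _); last first.
  by rewrite mulrnAr !exprS; congr (_ *+ _); ring.
case: a => [|a]; rewrite ?mulr0n ?mul0r // mulrnAl !exprS.
by congr (_ *+ _); ring.
Qed.

(** * Peaks of a word under insertion of a largest letter *)

Section PeaksUnderInsertion.
Local Open Scope nat_scope.

Definition peak (u : nat -> nat) (i : nat) : bool :=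
  (u i.-1 < u i) && (u i.+1 < u i).

Definition insert_at (u : nat -> nat) (j M i : nat) : nat :=
  if i < j then u i else if i == j then M else u i.-1.

Lemma peak0 u : peak u 0 = false.
Proof. by rewrite /peak ltnn. Qed.

Lemma count_peak_sum u N m : N <= m ->
  count (peak u) (index_iota 1 N) = \sum_(0 <= i < m) ((i < N) && peak u i).
Proof.
move=> leNm; transitivity (count (peak u) (index_iota 0 N)).
  by case: N {leNm} => //= N; rewrite /index_iota /= peak0 !subn1.
rewrite -sum1_count (big_nat_widen _ _ _ _ _ leNm) big_mkcond /=.
by apply: eq_bigr => i _; rewrite andbC; case: (_ && _).
Qed.

(* A letter M larger than all others, inserted just before position j, creates a
   peak and destroys the one that may sit at position j - 1 or j. *)
Lemma peaks_insert u N M j : (forall i, u i < M) -> 0 < j <= N ->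
  count (peak (insert_at u j M)) (index_iota 1 N.+1)
    + (((j.-1 < N) && peak u j.-1) + ((j < N) && peak u j))
  = (count (peak u) (index_iota 1 N)).+1.
Proof.
move=> uM; case: j => // k /= ltkN.
rewrite (@count_peak_sum _ _ N.+3) ?(leqW (leqnSn _)) //.
rewrite (@count_peak_sum _ _ N.+2) ?(leqW (leqnSn _)) //.
have lekN : k <= N by exact: ltnW.
(* Peaks below [k] are untouched and those from [k.+3] on are shifted by one. What remains is [k],
   [k.+1], [k.+2] in the new word against [k], [k.+1] in the old one. *)
rewrite (big_cat_nat (n := k.+3)) //=.
rewrite [in RHS](big_cat_nat (n := k.+2)) //=.
rewrite big_add1 /= !(big_nat_recr _ 0) //=.
set u' := insert_at u k.+1 M.
have -> : \sum_(0 <= i < k) ((i < N.+1) && peak u' i) =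
          \sum_(0 <= i < k) ((i < N) && peak u i).
  rewrite !big_nat; apply: eq_bigr => i /= ik.
  have -> : peak u' i = peak u i.
    by rewrite /peak /u' /insert_at !ifT //; lia.
  by congr (nat_of_bool (_ && _)); lia.
have -> : \sum_(k.+2 <= i < N.+2) ((i.+1 < N.+1) && peak u' i.+1) =
          \sum_(k.+2 <= i < N.+2) ((i < N) && peak u i).
  rewrite !big_nat; apply: eq_bigr => i /= /andP[ik _].
  have e m : k.+1 < m -> u' m = u m.-1.
    by move=> km; rewrite /u' /insert_at !ifF //; lia.
  rewrite ltnS; congr (nat_of_bool (_ && _)).
  by case: i ik => // i ik; rewrite /peak /= !e //; lia.
have uk : u' k = u k by rewrite /u' /insert_at ltnSn.
have uk1 : u' k.+1 = M by rewrite /u' /insert_at ltnn eqxx.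
have uk2 : u' k.+2 = u k.+1 by rewrite /u' /insert_at !ifF //; lia.
(* [M] is a peak at [k.+1], which prevents peaks at [k] and [k.+2]. *)
rewrite /(peak u' k) /(peak u' k.+1) /(peak u' k.+2) /= uk uk1 uk2.
have lt1 := uM k; have lt2 := uM k.+1.
rewrite lt1 lt2 (ltnNge M (u k)) (ltnW lt1) (ltnNge M (u k.+1)) (ltnW lt2) /=.
rewrite !andbF ltnS ltkN; lia.
Qed.

Lemma peaks_adjacent u i : peak u i.-1 + peak u i <= 1.
Proof.
case: i => [|i]; first by rewrite peak0.
rewrite /peak /=; lia.
Qed.

(** Each peak has two places beside it, just before and just after, where insertion trades it for
    the new one. Peaks are never adjacent, so these [2 * p] places are distinct; every other place
    gains a peak. *)
Lemma sum_peaks_insert (V : nmodType) (f : nat -> V) u N M :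
  (forall i, u i < M) ->
  let p := count (peak u) (index_iota 1 N) in
  (2 * p <= N) *
  (\sum_(1 <= j < N.+1)
      f (count (peak (insert_at u j M)) (index_iota 1 N.+1))
    = f p *+ (2 * p) + f p.+1 *+ (N - 2 * p))%R.
Proof.
move=> uM p.
(* [q j] is the number of counted peaks destroyed by inserting at [j], hence 0 or 1. *)
pose q j := ((j.-1 < N) && peak u j.-1) + ((j < N) && peak u j).
have q1 j : q j <= 1.
  apply: leq_trans (peaks_adjacent u j).
  rewrite /q; case: (_ < N); case: (_ < N) => //=.
  - by rewrite addn0 leq_addr.
  - by rewrite leq_addl.
(* A peak at [i] is counted twice, for [j = i] and for [j = i.+1]. *)
have sq : \sum_(1 <= j < N.+1) q j = 2 * p.
  rewrite big_split /= big_add1 /= -(count_peak_sum _ (leqnn N)).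
  rewrite mul2n -addnn; congr (_ + _).
  rewrite /p (count_peak_sum _ (leqnSn N)) [RHS]big_ltn //.
  by rewrite peak0 andbF.
have sqC : \sum_(1 <= j < N.+1) q j + \sum_(1 <= j < N.+1) (1 - q j) = N.
  rewrite -big_split /= -[RHS](subn1 N.+1) -[RHS]muln1 -sum_nat_const_nat.
  by apply: eq_bigr => j _; rewrite subnKC.
split; first by lia.
have -> : N - 2 * p = \sum_(1 <= j < N.+1) (1 - q j) by lia.
rewrite -{1}sq -!GRing.sumrMnr -big_split /= !big_nat.
apply: eq_bigr => j jN; have := peaks_insert uM jN; rewrite -/(q j) -/p.
have := q1 j; case: (q j) => [|[|//]] _; rewrite ?addn0 ?addn1.
  by move=> ->; rewrite GRing.mulr0n GRing.add0r.
by case=> ->; rewrite GRing.mulr0n GRing.addr0.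
Qed.

Lemma sigma_atS n (s : 'S_n) (i : 'I_n) : sigma_at s i.+1 = (s i).+1.
Proof.
by rewrite /sigma_at /= (nth_map i) ?nth_ord_enum // size_enum_ord.
Qed.

Lemma sigma_at_default n (s : 'S_n) i : n < i -> sigma_at s i = 0.
Proof. by move=> lt; rewrite /sigma_at nth_default //= size_map size_enum_ord. Qed.

Lemma sigma_at_lt n (s : 'S_n) i : sigma_at s i < n.+1.
Proof.
case: i => // i; have [ltin|leni] := ltnP i n; last by rewrite sigma_at_default.
by rewrite -[i]/(nat_of_ord (Ordinal ltin)) sigma_atS ltnS.
Qed.

(** Lifting values at [ord_max] changes none of them, while lifting indices at [j] moves those from
    [j] on by one. The shift to [j.+1] comes from positions in the word starting at 1. *)
Lemma sigma_at_lift n (s : 'S_n) (j : 'I_n.+1) :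
  sigma_at (lift_perm j ord_max s) =1 insert_at (sigma_at s) j.+1 n.+1.
Proof.
rewrite /insert_at => -[//|i].
have [ltin|leni] := ltnP i n.+1; last first.
  by rewrite sigma_at_default // !ifF ?sigma_at_default //; have := ltn_ord j; lia.
rewrite -[i]/(nat_of_ord (Ordinal ltin)) sigma_atS.
case: (unliftP j (Ordinal ltin)) => [k|] ->; last by rewrite lift_perm_id ltnn eqxx.
rewrite lift_perm_lift lift_max -sigma_atS /= /bump.
have [lejk|ltkj] := leqP j k; last by rewrite add0n ltnS ltkj.
rewrite add1n; move: (nat_of_ord j) (nat_of_ord k) lejk => a b leab.
by rewrite !ifF //; lia.
Qed.

Lemma left_peaks_lift n (s : 'S_n) (j : 'I_n.+1) :
  left_peaks (lift_perm j ord_max s) =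
  count (peak (insert_at (sigma_at s) j.+1 n.+1)) (index_iota 1 n.+1).
Proof. by apply: eq_count => i; rewrite /is_peak !sigma_at_lift. Qed.

Lemma exterior_peaks_lift n (s : 'S_n) (j : 'I_n.+1) :
  exterior_peaks (lift_perm j ord_max s) =
  count (peak (insert_at (sigma_at s) j.+1 n.+1)) (index_iota 1 n.+2).
Proof. by apply: eq_count => i; rewrite /is_peak !sigma_at_lift. Qed.

Lemma left_peaks_bound n (s : 'S_n) : 2 * left_peaks s <= n.
Proof.
by rewrite (sum_peaks_insert (fun=> 0) n (sigma_at_lt s)).
Qed.

Lemma exterior_peaks_bound n (s : 'S_n) : 2 * exterior_peaks s <= n.+1.
Proof.
by rewrite (sum_peaks_insert (fun=> 0) n.+1 (sigma_at_lt s)).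
Qed.

End PeaksUnderInsertion.

(** * Sums over permutations through insertion of the letter n+1 *)

(** Left peaks are the case [N = n] of [sum_peaks_insert], which omits the end of the word; that
    place preserves the count and gives the [+ 1]. *)
Lemma sum_left_peaks_lift (V : nmodType) (f : nat -> V) n (s : 'S_n) :
  \sum_(j < n.+1) f (left_peaks (lift_perm j ord_max s)) =
  f (left_peaks s) *+ (2 * left_peaks s + 1)
    + f (left_peaks s).+1 *+ (n - 2 * left_peaks s).
Proof.
rewrite big_ord_recr /= mulrnDr mulr1n addrAC; congr (_ + _).
  under eq_bigr => j _ do rewrite left_peaks_lift /=.
  rewrite -[RHS](sum_peaks_insert f n (sigma_at_lt s)).2 big_add1 /=.
  by rewrite big_mkord.
(* With n+1 at the end, position [n] becomes a candidate but is followed by a larger letter. *)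
congr f; rewrite left_peaks_lift /= (count_peak_sum _ (leqnn n.+1)).
rewrite [RHS](count_peak_sum (sigma_at s) (leqnSn n)) !big_nat_recr //=.
congr (_ + _)%N.
  rewrite !big_nat; apply: eq_bigr => i /= ltin.
  by rewrite ltin ltnS (ltnW ltin) /peak /insert_at !ifT //; lia.
rewrite /peak /insert_at ltnSn ltnn eqxx ltnn /=.
by rewrite (ltnNge n.+1) (ltnW (sigma_at_lt s n)) !andbF.
Qed.

Lemma sum_exterior_peaks_lift (V : nmodType) (f : nat -> V) n (s : 'S_n) :
  \sum_(j < n.+1) f (exterior_peaks (lift_perm j ord_max s)) =
  f (exterior_peaks s) *+ (2 * exterior_peaks s)
    + f (exterior_peaks s).+1 *+ (n.+1 - 2 * exterior_peaks s).
Proof.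
under eq_bigr => j _ do rewrite exterior_peaks_lift.
rewrite -[RHS](sum_peaks_insert f n.+1 (sigma_at_lt s)).2 big_add1 /=.
by rewrite big_mkord.
Qed.

(** Insertion is injective, since the place is recovered as the preimage of [ord_max]; it is
    bijective because (n+1)! = n! (n+1). *)
Lemma sum_lift_perm (V : nmodType) n (F : 'S_n.+1 -> V) :
  \sum_t F t = \sum_(s : 'S_n) \sum_(j < n.+1) F (lift_perm j ord_max s).
Proof.
rewrite pair_big /=.
rewrite (reindex (fun sj : 'S_n * 'I_n.+1 => lift_perm sj.2 ord_max sj.1)) //=.
apply/onW_bij/inj_card_bij => [[s i] [s' i'] /= eq_lift|]; last first.
  by rewrite card_prod !card_Sn card_ord factS mulnC.
have eq_i : i = i'.
  apply: (@perm_inj _ (lift_perm i ord_max s)).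
  by rewrite {2}eq_lift !lift_perm_id.
rewrite -eq_i in eq_lift *; congr (_, _); apply/permP => k.
by apply: (@lift_inj _ ord_max); rewrite -!(lift_perm_lift i) eq_lift.
Qed.

(** A word without exterior peaks has 2 * 0 places that preserve their number, so every insertion
    creates one. *)
Lemma Wnum_0 n : Wnum n.+1 0 = 0%N.
Proof.
rewrite /Wnum -sum1dep_card big_mkcond /=.
rewrite (sum_lift_perm (fun t => if exterior_peaks t == 0 then 1 else 0)%N).
rewrite big1 // => s _.
rewrite (sum_exterior_peaks_lift (fun k => if k == 0 then 1 else 0)%N).
by case: exterior_peaks => [|p] /=; rewrite ?mulr0n ?mul0rn.
Qed.

(** * The polynomials as sums over permutations, and their recurrences *)

Lemma sum_fibers (A : pzRingType) (T : finType) (g : T -> nat) (f : nat -> A) m :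
  (forall s, (g s < m)%N) ->
  \sum_(0 <= k < m) #|[set s | g s == k]|%:R * f k = \sum_s f (g s).
Proof.
move=> g_lt; rewrite (partition_big (fun s => Ordinal (g_lt s)) xpredT) //=.
rewrite big_mkord; apply: eq_bigr => k _.
rewrite (eq_bigr (fun=> f k)) => [|s /eqP <- //].
by rewrite sumr_const mulr_natl; congr (_ *+ _); apply: eq_card => s; rewrite inE.
Qed.

Lemma Lpoly_sum n :
  Lpoly n = \sum_(s : 'S_n)
    varx ^+ (2 * left_peaks s + 1) * vary ^+ (n - 2 * left_peaks s).
Proof.
case: n => [|n].
  (* The convention for [Lpoly 0] agrees with the term of the empty permutation. *)
  rewrite (eq_bigr (fun=> varx)) => [|s _]; last by rewrite expr1 mulr1.
  by rewrite sumr_const card_Sn.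
rewrite /Lpoly.
rewrite -(sum_fibers (g := @left_peaks n.+1)
  (fun k => varx ^+ (2 * k + 1) * vary ^+ (n.+1 - 2 * k)) (m := (n.+1)./2.+1)).
  by apply: eq_bigr => k _; rewrite mulrA.
move=> s; have := left_peaks_bound s; lia.
Qed.

Lemma Wpoly_sum n :
  Wpoly n = \sum_(s : 'S_n)
    varx ^+ (2 * exterior_peaks s) * vary ^+ (n.+1 - 2 * exterior_peaks s).
Proof.
case: n => [|n].
  rewrite (eq_bigr (fun=> vary)) => [|s _]; last by rewrite expr0 mul1r expr1.
  by rewrite sumr_const card_Sn.
rewrite /Wpoly.
rewrite -(sum_fibers (g := @exterior_peaks n.+1)
  (fun k => varx ^+ (2 * k) * vary ^+ (n.+2 - 2 * k)) (m := (n.+2)./2.+1)).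
  (* [Wpoly] starts at [k = 1]; the extra term [k = 0] vanishes. *)
  rewrite [RHS]big_ltn // -/(Wnum n.+1 0) Wnum_0 mul0r add0r.
  by apply: eq_bigr => k _; rewrite mulrA.
move=> s; have := exterior_peaks_bound s; lia.
Qed.

Lemma peak_deriv_sum (I : finType) (F : I -> Qxy) :
  peak_deriv (\sum_i F i) = \sum_i peak_deriv (F i).
Proof.
apply: (big_morph peak_deriv peak_derivD).
by rewrite /peak_deriv !mderiv0 !mulr0 addr0.
Qed.

Lemma LpolyS n : Lpoly n.+1 = peak_deriv (Lpoly n).
Proof.
rewrite !Lpoly_sum peak_deriv_sum sum_lift_perm; apply: eq_bigr => s _.
rewrite (sum_left_peaks_lift
  (fun k => varx ^+ (2 * k + 1) * vary ^+ (n.+1 - 2 * k))).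
(* The peak bound makes the truncated subtraction exact, so the exponents 2k+1 and n-2k match the
   two counts of places. *)
rewrite peak_deriv_monomial subSn ?left_peaks_bound //.
by congr (_ + varx ^+ _ * vary ^+ _ *+ _); lia.
Qed.

Lemma WpolyS n : Wpoly n.+1 = peak_deriv (Wpoly n).
Proof.
rewrite !Wpoly_sum peak_deriv_sum sum_lift_perm; apply: eq_bigr => s _.
rewrite (sum_exterior_peaks_lift
  (fun k => varx ^+ (2 * k) * vary ^+ (n.+2 - 2 * k))).
rewrite peak_deriv_monomial subSn ?exterior_peaks_bound //.
by congr (_ + varx ^+ _ * vary ^+ _ *+ _); lia.
Qed.

(** * The differential equations *)

Lemma Lseries_exp_deriv : Lseries = exp_deriv peak_deriv varx.
Proof.
apply: functional_extensionality => n; congr (_ *: _).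
by elim: n => //= n <-; exact: LpolyS.
Qed.

Lemma Wseries_exp_deriv : Wseries = exp_deriv peak_deriv vary.
Proof.
apply: functional_extensionality => n; congr (_ *: _).
by elim: n => //= n <-; exact: WpolyS.
Qed.

Lemma Lseries_deriv : (Lseries^`())%fps = (Lseries * Wseries)%fps.
Proof.
rewrite Lseries_exp_deriv Wseries_exp_deriv deriv_exp_deriv peak_deriv_x.
exact: exp_derivM peak_derivD peak_derivM _ _.
Qed.

Lemma Wseries_deriv : (Wseries^`())%fps = (Lseries * Lseries)%fps.
Proof.
rewrite Lseries_exp_deriv Wseries_exp_deriv deriv_exp_deriv peak_deriv_y expr2.
exact: exp_derivM peak_derivD peak_derivM _ _.
Qed.

Lemma Lseries_sqr : (Lseries * Lseries)%fps =
  (Wseries * Wseries + (varx ^+ 2 - vary ^+ 2)%:S)%fps.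
Proof.
have Dxy : peak_deriv (varx ^+ 2 - vary ^+ 2) = 0.
  rewrite /peak_deriv !mderivB !expr2 !mderivM !mderiv_var /=; ring.
rewrite Lseries_exp_deriv Wseries_exp_deriv -(exp_deriv_const peak_derivD Dxy).
rewrite -!(exp_derivM peak_derivD peak_derivM) -(exp_derivD peak_derivD).
by congr (exp_deriv _ _); ring.
Qed.

Theorem theorem2p2 :
  [/\ (exists S : fps Qxy,
        unique (is_fps_sqrt (Lseries * Lseries - (varx ^+ 2)%:S
                               + (vary ^+ 2)%:S)%fps vary) S
        /\ (Lseries^`())%fps = (Lseries * S)%fps),
      (Wseries^`())%fps
        = (Wseries * Wseries + (varx ^+ 2)%:S - (vary ^+ 2)%:S)%fps,
      Lseries 0%N = varx
    & Wseries 0%N = vary].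
Proof.
have L0 : Lseries 0%N = varx by rewrite /Lseries fact0 invr1 scale1r.
have W0 : Wseries 0%N = vary by rewrite /Wseries fact0 invr1 scale1r.
have const_sub (F : fps Qxy) : (F + (varx ^+ 2 - vary ^+ 2)%:S)%fps =
    (F + (varx ^+ 2)%:S - (vary ^+ 2)%:S)%fps.
  apply: functional_extensionality => n.
  by rewrite /fps_add /fps_sub; case: n => [|n] /=; rewrite ?subr0 ?addrA.
have sqrtW : is_fps_sqrt (Lseries * Lseries - (varx ^+ 2)%:S
                            + (vary ^+ 2)%:S)%fps vary Wseries.
  split=> //; rewrite Lseries_sqr const_sub; apply: functional_extensionality => n.
  by rewrite /fps_add /fps_sub; ring.
have nz2 : 2%:R != 0 :> Qxy by rewrite -mpolyC_nat mpolyC_eq0 pnatr_eq0.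
(* The partial derivative of [vary] in its own variable is 1. *)
have nzy : vary != 0.
  by apply/eqP => /(congr1 (mderiv ord_max)) /eqP;
    rewrite mderiv_var mderiv0 eqxx oner_eq0.
split=> //; last by rewrite Wseries_deriv Lseries_sqr const_sub.
exists Wseries; split; last exact: Lseries_deriv.
by split=> // S sqrtS; exact: fps_sqrt_unique nz2 nzy sqrtW sqrtS.
Qed.
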